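(* Let $X$ be a Hilbert space and let $T:X\rightrightarrows X$ be a proper set-valued mapping with norm-closed graph and convex domain $\operatorname{dom}T$. Then the following are equivalent: (i) $T$ is maximal monotone on $X$; (ii) $T$ is semilocally hypomonotone on $X$ (i.e., at every point of $\operatorname{dom}T$) and for every $(u,v)\in\operatorname{gph}T$ one has $\langle z,w\rangle\ge0$ whenever $w\in X$ and $z\in\widehat D^*T(u,v)(w)$.
   Context: $X$ is a real Hilbert space identified with its dual. For $T:X\rightrightarrows X$, $\operatorname{dom}T=\{u:T(u)\ne\emptyset\}$, $\operatorname{gph}T=\{(u,v):v\in T(u)\}$, proper means $\operatorname{dom}T\ne\emptyset$. $T$ is monotone if $\langle v_1-v_2,u_1-u_2\rangle\ge0$ on $\operatorname{gph}T$; maximal monotone if monotone and its graph is not properly contained in the graph of another monotone mapping. $T$ is semilocally hypomonotone at $\bar u\in\operatorname{dom}T$ if there exist a neighborhood $U$ of $\bar u$ and $r>0$ with $\langle v_1-v_2,u_1-u_2\rangle\ge -r\|u_1-u_2\|^2$ for all $(u_1,v_1),(u_2,v_2)\in\operatorname{gph}T\cap(U\times X)$. Regular normal cone to $\Omega\subset X\times X$ at $\bar p\in\Omega$: $\widehat N(\bar p;\Omega)=\{q:\limsup_{p\to\bar p,\,p\in\Omega}\langle q,p-\bar p\rangle/\|p-\bar p\|\le0\}$. Regular coderivative: $\widehat D^*T(u,v)(w)=\{z: (z,-w)\in\widehat N((u,v);\operatorname{gph}T)\}$. *)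

(* Defs.v *)
From Stdlib Require Import Reals.
Open Scope R_scope.
Set Implicit Arguments.

Record Hilbert := {
  H_car :> Type;
  H_zero : H_car;
  H_add : H_car -> H_car -> H_car;
  H_opp : H_car -> H_car;
  H_scal : R -> H_car -> H_car;
  H_inner : H_car -> H_car -> R;
  H_addA : forall x y z, H_add x (H_add y z) = H_add (H_add x y) z;
  H_addC : forall x y, H_add x y = H_add y x;
  H_add0 : forall x, H_add x H_zero = x;
  H_addN : forall x, H_add x (H_opp x) = H_zero;
  H_scal1 : forall x, H_scal 1 x = x;
  H_scalA : forall a b x, H_scal a (H_scal b x) = H_scal (a * b) x;
  H_scalDr : forall a x y, H_scal a (H_add x y) = H_add (H_scal a x) (H_scal a y);
  H_scalDl : forall a b x, H_scal (a + b) x = H_add (H_scal a x) (H_scal b x);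
  H_innerC : forall x y, H_inner x y = H_inner y x;
  H_innerDl : forall x y z, H_inner (H_add x y) z = H_inner x z + H_inner y z;
  H_innerZl : forall a x y, H_inner (H_scal a x) y = a * H_inner x y;
  H_inner_ge0 : forall x, 0 <= H_inner x x;
  H_inner_eq0 : forall x, H_inner x x = 0 -> x = H_zero;
  H_complete : forall u : nat -> H_car,
    (forall eps, 0 < eps -> exists N, forall m n, (N <= m)%nat -> (N <= n)%nat ->
       sqrt (H_inner (H_add (u m) (H_opp (u n))) (H_add (u m) (H_opp (u n)))) < eps) ->
    exists l, forall eps, 0 < eps -> exists N, forall n, (N <= n)%nat ->
       sqrt (H_inner (H_add (u n) (H_opp l)) (H_add (u n) (H_opp l))) < eps
}.

Section Ops.
Variable X : Hilbert.
Definition hsub (x y : X) : X := H_add X x (H_opp X y).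
Definition hnorm (x : X) : R := sqrt (H_inner X x x).

(* Set-valued mappings T : X ⇉ X, given by their graph: T u v  <->  v ∈ T(u). *)
Definition setmap := X -> X -> Prop.

Definition dom (T : setmap) (u : X) : Prop := exists v, T u v.
Definition proper (T : setmap) : Prop := exists u, dom T u.

Definition convex (C : X -> Prop) : Prop :=
  forall u1 u2 t, C u1 -> C u2 -> 0 <= t <= 1 ->
    C (H_add X (H_scal X t u1) (H_scal X (1 - t) u2)).

Definition pnorm (u v : X) : R := sqrt (hnorm u ^ 2 + hnorm v ^ 2).

Definition closed_graph (T : setmap) : Prop :=
  forall u v, (forall eps, 0 < eps -> exists u' v', T u' v' /\
                 pnorm (hsub u' u) (hsub v' v) < eps) -> T u v.

Definition monotone (T : setmap) : Prop :=
  forall u1 v1 u2 v2, T u1 v1 -> T u2 v2 ->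
    0 <= H_inner X (hsub v1 v2) (hsub u1 u2).

Definition maximal_monotone (T : setmap) : Prop :=
  monotone T /\
  forall S : setmap, monotone S -> (forall u v, T u v -> S u v) ->
    forall u v, S u v -> T u v.

Definition neighborhood (ub : X) (U : X -> Prop) : Prop :=
  exists delta, 0 < delta /\ forall u, hnorm (hsub u ub) < delta -> U u.

Definition semilocally_hypomonotone_at (T : setmap) (ub : X) : Prop :=
  dom T ub /\
  exists U r, neighborhood ub U /\ 0 < r /\
    forall u1 v1 u2 v2, T u1 v1 -> T u2 v2 -> U u1 -> U u2 ->
      - r * hnorm (hsub u1 u2) ^ 2 <= H_inner X (hsub v1 v2) (hsub u1 u2).

Definition semilocally_hypomonotone (T : setmap) : Prop :=
  forall ub, dom T ub -> semilocally_hypomonotone_at T ub.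

(* Regular normal cone to Ω ⊆ X × X at (ub,vb) ∈ Ω: (q1,q2) ∈ N̂ iff
   limsup_{p → p̄, p ∈ Ω} <q, p - p̄> / ||p - p̄|| <= 0, unfolded. *)
Definition regular_normal (Om : X -> X -> Prop) (ub vb q1 q2 : X) : Prop :=
  forall eps, 0 < eps -> exists delta, 0 < delta /\
    forall u v, Om u v -> 0 < pnorm (hsub u ub) (hsub v vb) < delta ->
      H_inner X q1 (hsub u ub) + H_inner X q2 (hsub v vb)
        <= eps * pnorm (hsub u ub) (hsub v vb).

Definition reg_coderiv (T : setmap) (u v w z : X) : Prop :=
  regular_normal T u v z (H_opp X w).
End Ops.
Arguments convex {X} C.
Arguments hnorm {X} x.
Arguments hsub {X} x y.
Arguments pnorm {X} u v.

(* Main.v *)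
Require Import Defs.
From Stdlib Require Import Reals Lra Lia ClassicalEpsilon.
Open Scope R_scope.

(* (i) => (ii): By Minty's theorem T + I is onto.  For a normal (z,-w) at (u,v), solving
   u' + v' = u + v + t (z - w) and letting t decrease to 0 gives |z - w| <= |z + w|.

   (ii) => (i): Fix (u0,v0) in gph T, a point y and 0 < mu < lam.  A smooth variational principle
   applied to |v + lam u - y| + mu |u - u0| on gph T shows that some (u,v) in gph T has
   v + lam u = y and, up to an arbitrarily small error, mu |u - u0| <= |v0 + lam u0 - y|: a nonzero
   residual would yield z in D^*T(u,v)(w) with <z,w> < 0.  On a small ball where T is
   r-hypomonotone and lam > r, this solution is unique, so with a = u2 - u1 and b = v2 - v1 one
   gets lam |a| <= |b + lam a|, that is |b|^2 + 2 lam <a,b> >= 0; lam -> oo makes T monotone on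
   that ball.  Adding up along segments of the convex domain makes T monotone, and T + I is onto,
   hence T is maximal. *)

Local Notation "x [+] y" := (H_add _ x y) (at level 50, left associativity).
Local Notation "x [-] y" := (hsub x y) (at level 50, left associativity).
Local Notation "a [*] x" := (H_scal _ a x) (at level 40).
Local Notation "<< x , y >>" := (H_inner _ x y).

(** * Inner product and norm calculus in a Hilbert space *)

Lemma inner_Dr (X : Hilbert) (x y z : X) : <<x, y [+] z>> = <<x, y>> + <<x, z>>.
Proof. now rewrite H_innerC, H_innerDl, (H_innerC X y), (H_innerC X z). Qed.

Lemma inner_Zr (X : Hilbert) a (x y : X) : <<x, a [*] y>> = a * <<x, y>>.
Proof. now rewrite H_innerC, H_innerZl, (H_innerC X y). Qed.

Lemma inner_0l (X : Hilbert) (y : X) : <<H_zero X, y>> = 0.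
Proof.
  pose proof (H_innerDl X (H_zero X) (H_zero X) y) as H.
  rewrite H_add0 in H. lra.
Qed.

Lemma inner_0r (X : Hilbert) (y : X) : <<y, H_zero X>> = 0.
Proof. rewrite H_innerC. apply inner_0l. Qed.

Lemma inner_Nl (X : Hilbert) (x y : X) : <<H_opp X x, y>> = - <<x, y>>.
Proof.
  pose proof (H_innerDl X x (H_opp X x) y) as H.
  rewrite H_addN, inner_0l in H. lra.
Qed.

Lemma inner_Nr (X : Hilbert) (x y : X) : <<x, H_opp X y>> = - <<x, y>>.
Proof. rewrite H_innerC, inner_Nl, H_innerC. reflexivity. Qed.

(** After the bilinear expansion each pair of vectors keeps one orientation, so that [ring] and
    [lra] see one atom per inner product. *)
Ltac inner_expand :=
  unfold hsub;
  repeat first [ rewrite H_innerDl | rewrite inner_Dr | rewrite H_innerZl | rewrite inner_Zr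
               | rewrite inner_Nl | rewrite inner_Nr | rewrite inner_0l | rewrite inner_0r ];
  repeat match goal with
  | |- context [H_inner ?X ?a ?b] =>
      match goal with
      | |- context [H_inner X b a] =>
          tryif constr_eq a b then fail else rewrite (H_innerC X b a)
      end
  end.

(** Positive definiteness turns a vector identity into a scalar one; [vec] relies on this. *)
Lemma hilbert_eq (X : Hilbert) (x y : X) : <<x [-] y, x [-] y>> = 0 -> x = y.
Proof.
  intros H. apply H_inner_eq0 in H. unfold hsub in H.
  assert (E : x [+] (H_opp X y [+] y) = H_zero X [+] y) by now rewrite H_addA, H.
  rewrite (H_addC X (H_opp X y)), H_addN, H_add0, H_addC, H_add0 in E. exact E.
Qed.

Ltac vec := apply hilbert_eq; inner_expand; ring.

Lemma hnorm_ge0 (X : Hilbert) (x : X) : 0 <= hnorm x.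
Proof. apply sqrt_pos. Qed.

Lemma hnorm_sq (X : Hilbert) (x : X) : hnorm x ^ 2 = <<x, x>>.
Proof. apply pow2_sqrt, H_inner_ge0. Qed.

Lemma hnorm_gt0 (X : Hilbert) (x y : X) : x <> y -> 0 < hnorm (x [-] y).
Proof.
  intros N. destruct (Rle_lt_or_eq_dec _ _ (hnorm_ge0 X (x [-] y))) as [H|H]; auto.
  contradict N. apply hilbert_eq. rewrite <- hnorm_sq, <- H. ring.
Qed.

Lemma sq_le_le (a b : R) : 0 <= b -> a ^ 2 <= b ^ 2 -> a <= b.
Proof. intros. nra. Qed.

Lemma inner_le (X : Hilbert) (x y : X) : <<x, y>> <= hnorm x * hnorm y.
Proof.
  pose proof (hnorm_ge0 X x). pose proof (hnorm_ge0 X y).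
  pose proof (hnorm_sq X x) as Ex. pose proof (hnorm_sq X y) as Ey.
  (* The square of |y| x - |x| y is 2 |x| |y| (|x| |y| - <x, y>); dividing by |x| |y| gives
     Cauchy-Schwarz. *)
  pose proof (H_inner_ge0 X (hnorm y [*] x [-] hnorm x [*] y)) as P.
  revert P. inner_expand. rewrite <- Ex, <- Ey. intros P.
  destruct (Req_dec (hnorm x) 0) as [Zx|Zx].
  { assert (E : x = H_zero X) by (apply H_inner_eq0; rewrite <- Ex, Zx; ring).
    rewrite E at 1. rewrite inner_0l. nra. }
  destruct (Req_dec (hnorm y) 0) as [Zy|Zy].
  { assert (E : y = H_zero X) by (apply H_inner_eq0; rewrite <- Ey, Zy; ring).
    rewrite E at 1. rewrite inner_0r. nra. }
  assert (0 < hnorm x * hnorm y) by nra. nra.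
Qed.

Lemma inner_ge (X : Hilbert) (x y : X) : - (hnorm x * hnorm y) <= <<x, y>>.
Proof.
  pose proof (inner_le X (H_opp X x) y) as H.
  assert (E : hnorm (H_opp X x) = hnorm x) by (unfold hnorm; f_equal; inner_expand; ring).
  rewrite inner_Nl, E in H. lra.
Qed.

Lemma hnorm_add (X : Hilbert) (x y : X) : hnorm (x [+] y) <= hnorm x + hnorm y.
Proof.
  pose proof (hnorm_ge0 X x). pose proof (hnorm_ge0 X y).
  apply sq_le_le; [lra|]. rewrite hnorm_sq. inner_expand.
  pose proof (inner_le X x y). pose proof (hnorm_sq X x). pose proof (hnorm_sq X y). nra.
Qed.

Lemma hnorm_scal (X : Hilbert) a (x : X) : 0 <= a -> hnorm (a [*] x) = a * hnorm x.
Proof.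
  intros Ha. pose proof (hnorm_ge0 X x). pose proof (hnorm_ge0 X (a [*] x)).
  assert (E : hnorm (a [*] x) ^ 2 = (a * hnorm x) ^ 2)
    by (rewrite Rpow_mult_distr, !hnorm_sq; inner_expand; ring).
  apply Rle_antisym; apply sq_le_le; nra.
Qed.

Lemma hnorm_subC (X : Hilbert) (x y : X) : hnorm (x [-] y) = hnorm (y [-] x).
Proof. unfold hnorm. f_equal. inner_expand. ring. Qed.

Lemma hnorm_tri (X : Hilbert) (x y z : X) : hnorm (x [-] z) <= hnorm (x [-] y) + hnorm (y [-] z).
Proof.
  replace (x [-] z) with ((x [-] y) [+] (y [-] z)) by vec. apply hnorm_add.
Qed.

(** * Geometric sequences, limits and approximate minimizers *)

Lemma half_pow_gt0 n : 0 < (/ 2) ^ n.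
Proof. apply pow_lt. lra. Qed.

Lemma half_pow_le1 n : (/ 2) ^ n <= 1.
Proof. induction n; simpl; [lra|]. pose proof (half_pow_gt0 n). lra. Qed.

Lemma half_pow_small eps : 0 < eps -> exists N, forall n, (N <= n)%nat -> (/ 2) ^ n < eps.
Proof.
  intros He. destruct (pow_lt_1_zero (/ 2)) with (y := eps) as [N HN]; auto.
  { rewrite Rabs_right; lra. }
  exists N. intros n Hn. specialize (HN n Hn). rewrite Rabs_right in HN; auto.
  pose proof (half_pow_gt0 n). lra.
Qed.

(** Serves as the passage to the limit in every estimate along an iteration. *)
Lemma le0_of_half_pow (A K : R) : (forall n, A <= K * (/ 2) ^ n) -> A <= 0.
Proof.
  intros H. destruct (Rle_lt_dec A 0) as [|P]; auto. exfalso.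
  pose proof (Rabs_pos K).
  destruct (half_pow_small (A / (Rabs K + 1))) as [N HN].
  { apply Rdiv_lt_0_compat; lra. }
  specialize (HN N (le_n N)). specialize (H N). pose proof (half_pow_gt0 N).
  apply (Rmult_lt_compat_r (Rabs K + 1)) in HN; [|lra].
  unfold Rdiv in HN. rewrite Rmult_assoc, Rinv_l in HN by lra.
  pose proof (Rle_abs K). nra.
Qed.

Lemma geometric_cv (X : Hilbert) (x : nat -> X) (K : R) :
  (forall n, hnorm (x (S n) [-] x n) <= K * (/ 2) ^ n) ->
  exists l, forall n, hnorm (x n [-] l) <= 2 * K * (/ 2) ^ n.
Proof.
  intros H.
  assert (HK : 0 <= K).
  { specialize (H 0%nat). simpl in H. pose proof (hnorm_ge0 X (x 1%nat [-] x 0%nat)). lra. }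
  (* The exact geometric sum, a form that the induction on [k] reproduces. *)
  assert (C : forall n k, hnorm (x (n + k)%nat [-] x n) <= 2 * K * ((/ 2) ^ n - (/ 2) ^ (n + k))).
  { intros n k. induction k as [|k IH].
    - rewrite Nat.add_0_r. replace (x n [-] x n) with (0 [*] x n) by vec.
      rewrite hnorm_scal; lra.
    - rewrite Nat.add_succ_r. pose proof (hnorm_tri X (x (S (n + k))) (x (n + k)%nat) (x n)).
      specialize (H (n + k)%nat). simpl pow. lra. }
  assert (C' : forall n m, (n <= m)%nat -> hnorm (x m [-] x n) <= 2 * K * (/ 2) ^ n).
  { intros n m L. replace m with (n + (m - n))%nat by lia. specialize (C n (m - n)%nat).
    pose proof (half_pow_gt0 (n + (m - n))). nra. }
  destruct (H_complete X x) as [l Hl].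
  { intros eps He. destruct (half_pow_small (eps / (2 * K + 1))) as [N HN].
    { apply Rdiv_lt_0_compat; lra. }
    assert (B : 2 * K * (/ 2) ^ N < eps).
    { specialize (HN N (le_n N)). pose proof (half_pow_gt0 N).
      apply (Rmult_lt_compat_r (2 * K + 1)) in HN; [|lra].
      unfold Rdiv in HN. rewrite Rmult_assoc, Rinv_l in HN by lra. nra. }
    assert (mono : forall n, (N <= n)%nat -> 2 * K * (/ 2) ^ n < eps).
    { intros n Hn. replace n with (N + (n - N))%nat by lia. rewrite pow_add.
      pose proof (half_pow_gt0 N). pose proof (half_pow_le1 (n - N)).
      assert (0 <= 2 * K * (/ 2) ^ N) by nra. nra. }
    exists N. intros m n Hm Hn. change (hnorm (x m [-] x n) < eps).
    destruct (Nat.le_ge_cases m n) as [L|L].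
    - rewrite hnorm_subC. eapply Rle_lt_trans; [apply C'; exact L|]. auto.
    - eapply Rle_lt_trans; [apply C'; exact L|]. auto. }
  exists l. intros n. apply le_epsilon. intros eps He.
  destruct (Hl eps He) as [N HN].
  pose proof (HN (max n N) (Nat.le_max_r _ _)) as H1. change (hnorm (x (max n N) [-] l) < eps) in H1.
  pose proof (C' n (max n N) (Nat.le_max_l _ _)) as H2.
  pose proof (hnorm_tri X (x n) (x (max n N)) l) as H3.
  rewrite (hnorm_subC X (x n) (x (max n N))) in H3. lra.
Qed.

Lemma approx_inf (A : Type) (D : A -> Prop) (f : A -> R) (p0 : A) (B eps : R) :
  D p0 -> (forall p, D p -> B <= f p) -> 0 < eps ->
  exists p, D p /\ forall p', D p' -> f p <= f p' + eps.
Proof.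
  intros H0 HB He.
  (* [completeness] yields suprema, so the infimum of [f] appears as minus the supremum [m] of
     [- f]. *)
  destruct (completeness (fun s => exists p, D p /\ s = - f p)) as [m [Hm1 Hm2]].
  - exists (- B). intros s [p [Hp ->]]. specialize (HB p Hp). lra.
  - exists (- f p0), p0. auto.
  - destruct (classic (exists p, D p /\ - f p > m - eps)) as [[p [Hp L]]|N].
    + exists p. split; auto. intros p' Hp'.
      specialize (Hm1 (- f p') (ex_intro _ p' (conj Hp' eq_refl))). lra.
    + exfalso. assert (m <= m - eps); [|lra]. apply Hm2. intros s [p [Hp ->]].
      apply Rnot_lt_le. intros L. apply N. exists p. split; auto.
Qed.

(** * The product Hilbert space *)

Lemma prod_complete (X : Hilbert) (u : nat -> X * X) :
  (forall eps, 0 < eps -> exists N, forall m n, (N <= m)%nat -> (N <= n)%nat ->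
     sqrt (<<fst (u m) [-] fst (u n), fst (u m) [-] fst (u n)>>
           + <<snd (u m) [-] snd (u n), snd (u m) [-] snd (u n)>>) < eps) ->
  exists l : X * X, forall eps, 0 < eps -> exists N, forall n, (N <= n)%nat ->
     sqrt (<<fst (u n) [-] fst l, fst (u n) [-] fst l>>
           + <<snd (u n) [-] snd l, snd (u n) [-] snd l>>) < eps.
Proof.
  intros H.
  destruct (H_complete X (fun n => fst (u n))) as [l1 H1].
  { intros eps He. destruct (H eps He) as [N HN]. exists N. intros m n Hm Hn.
    eapply Rle_lt_trans; [|apply (HN m n Hm Hn)]. apply sqrt_le_1_alt.
    pose proof (H_inner_ge0 X (snd (u m) [-] snd (u n))). unfold hsub in *. lra. }
  destruct (H_complete X (fun n => snd (u n))) as [l2 H2].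
  { intros eps He. destruct (H eps He) as [N HN]. exists N. intros m n Hm Hn.
    eapply Rle_lt_trans; [|apply (HN m n Hm Hn)]. apply sqrt_le_1_alt.
    pose proof (H_inner_ge0 X (fst (u m) [-] fst (u n))). unfold hsub in *. lra. }
  exists (l1, l2). intros eps He. simpl.
  destruct (H1 (eps / 2)) as [N1 HN1]; [lra|]. destruct (H2 (eps / 2)) as [N2 HN2]; [lra|].
  exists (max N1 N2). intros n Hn.
  specialize (HN1 n ltac:(lia)). specialize (HN2 n ltac:(lia)).
  change (hnorm (fst (u n) [-] l1) < eps / 2) in HN1.
  change (hnorm (snd (u n) [-] l2) < eps / 2) in HN2.
  pose proof (hnorm_ge0 X (fst (u n) [-] l1)). pose proof (hnorm_ge0 X (snd (u n) [-] l2)).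
  rewrite <- (sqrt_pow2 eps) by lra. rewrite <- !hnorm_sq. apply sqrt_lt_1_alt.
  split; nra.
Qed.

(** The space in which graphs live; its norm is [pnorm]. Both minimization arguments below are
    applied in it. *)
Definition prodH (X : Hilbert) : Hilbert.
Proof.
  refine {| H_car := (X * X)%type;
    H_zero := (H_zero X, H_zero X);
    H_add := fun p q => (fst p [+] fst q, snd p [+] snd q);
    H_opp := fun p => (H_opp X (fst p), H_opp X (snd p));
    H_scal := fun a p => (a [*] fst p, a [*] snd p);
    H_inner := fun p q => <<fst p, fst q>> + <<snd p, snd q>>;
    H_complete := @prod_complete X |}.
  - intros [] [] []; simpl; f_equal; apply H_addA.
  - intros [] []; simpl; f_equal; apply H_addC.
  - intros []; simpl; f_equal; apply H_add0.
  - intros []; simpl; f_equal; apply H_addN.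
  - intros []; simpl; f_equal; apply H_scal1.
  - intros a b []; simpl; f_equal; apply H_scalA.
  - intros a [] []; simpl; f_equal; apply H_scalDr.
  - intros a b []; simpl; f_equal; apply H_scalDl.
  - intros [] []; simpl; f_equal; apply H_innerC.
  - intros [] [] []; simpl; rewrite !H_innerDl; ring.
  - intros a [] []; simpl; rewrite !H_innerZl; ring.
  - intros []; simpl; apply Rplus_le_le_0_compat; apply H_inner_ge0.
  - intros [x y] E; simpl in *. pose proof (H_inner_ge0 X x). pose proof (H_inner_ge0 X y).
    f_equal; apply H_inner_eq0; lra.
Defined.

Lemma pnorm_hnorm (X : Hilbert) (u v : X) : pnorm u v = @hnorm (prodH X) (u, v).
Proof. unfold pnorm. rewrite !hnorm_sq. reflexivity. Qed.

(** * A smooth variational principle *)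

(** State after [n] steps: [y] is the iterate, [e] the linear part left by recentring. The weight
    [2 * d * (1 - (/ 2) ^ n)] is the sum of d 2^(-i) over i < n, and [y] minimizes the perturbed
    objective up to d 8^(-n) / 2. *)
Definition vp_inv (X : Hilbert) (D : X -> Prop) (F : X -> R) (p0 : X) (d : R) (n : nat)
  (y e : X) : Prop :=
  D y /\ hnorm e <= 4 * d * (1 - (/ 2) ^ n) /\
  F y <= F p0 + d + 18 * d * (1 - (/ 2) ^ n) /\
  forall z, D z ->
    F y - 2 * d * (1 - (/ 2) ^ n) * hnorm (z [-] y) ^ 2 + 2 * <<e, z [-] y>>
      - d * ((/ 2) ^ n) ^ 3 / 2 <= F z.

Lemma vp_step (X : Hilbert) (D : X -> Prop) (F : X -> R) (p0 : X) (d : R) (n : nat) (y e : X) :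
  0 < d -> vp_inv X D F p0 d n y e ->
  exists y' e', vp_inv X D F p0 d (S n) y' e' /\
    hnorm (y' [-] y) <= (/ 2) ^ n /\ hnorm (e' [-] e) <= 2 * d * (/ 2) ^ n.
Proof.
  intros Hd (Dy & He & HF & Hmin). unfold vp_inv. change ((/ 2) ^ S n) with (/ 2 * (/ 2) ^ n).
  pose proof (half_pow_gt0 n) as Hq. pose proof (half_pow_le1 n) as Hq1.
  set (q := (/ 2) ^ n) in *.
  (* The weight once the new penalty d q |z - y|^2 has joined the quadratic. *)
  set (c := 2 * d * (1 - / 2 * q)).
  assert (Hc : 0 <= c <= 2 * d) by (unfold c; split; nra).
  destruct (approx_inf X D (fun z => F z + c * hnorm (z [-] y) ^ 2 - 2 * <<e, z [-] y>>)
              y (F y - d * q ^ 3 / 2) (d * (/ 2 * q) ^ 3 / 2)) as [y' [Dy' Hy']]; auto.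
  { intros z Dz. specialize (Hmin z Dz).
    assert (0 <= d * q * hnorm (z [-] y) ^ 2) by
      (apply Rmult_le_pos; [nra|apply pow2_ge_0]).
    unfold c. nra. }
  { assert (0 < (/ 2 * q) ^ 3) by (apply pow_lt; lra). nra. }
  (* Comparing [y] and [y'] in both minimality estimates bounds d q |y' - y|^2 by the two
     tolerances, together below d q^3. *)
  assert (Hdist : hnorm (y' [-] y) <= q).
  { apply sq_le_le; [lra|]. specialize (Hy' y Dy). specialize (Hmin y' Dy').
    replace (y [-] y) with (0 [*] y) in Hy' by vec.
    rewrite hnorm_scal, inner_Zr in Hy' by lra. unfold c in Hy'.
    assert (d * q * hnorm (y' [-] y) ^ 2 <= d * q * q ^ 2).
    { assert (0 < d * q ^ 3) by (apply Rmult_lt_0_compat; [|apply pow_lt]; lra). nra. }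
    apply Rmult_le_reg_l with (d * q); auto. nra. }
  pose proof (hnorm_ge0 X (y' [-] y)) as Hpos.
  (* Recentring the quadratic from [y] to [y'] moves its cross term into the linear part. *)
  exists y', (e [-] c [*] (y' [-] y)).
  assert (HD : hnorm ((e [-] c [*] (y' [-] y)) [-] e) <= 2 * d * q).
  { replace ((e [-] c [*] (y' [-] y)) [-] e) with (c [*] (y [-] y')) by vec.
    rewrite hnorm_scal by lra. rewrite hnorm_subC. nra. }
  split; [|split; auto]. split; [|split; [|split]]; auto.
  - replace (e [-] c [*] (y' [-] y)) with (((e [-] c [*] (y' [-] y)) [-] e) [+] e) by vec.
    eapply Rle_trans; [apply hnorm_add|]. lra.
  (* The allowed growth is 9 d q: at most 8 d q from 2 <e, y' - y>, the rest from the tolerance. *)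
  - specialize (Hy' y Dy).
    replace (y [-] y) with (0 [*] y) in Hy' by vec.
    rewrite hnorm_scal, inner_Zr in Hy' by lra.
    pose proof (inner_le X e (y' [-] y)) as CS. pose proof (hnorm_ge0 X e) as Hepos.
    assert (hnorm e * hnorm (y' [-] y) <= 4 * d * q) by nra.
    assert ((/ 2 * q) ^ 3 <= q) by nra.
    pose proof (pow2_ge_0 (hnorm (y' [-] y))). nra.
  - intros z Dz. specialize (Hy' z Dz). fold c.
    apply Rminus_le. apply Rle_minus in Hy'. eapply Rle_trans; [|exact Hy'].
    apply Req_le. rewrite !hnorm_sq. inner_expand. field.
Qed.

(* Borwein-Preiss: y_(n+1) almost minimizes the previous objective plus d 2^(-n) |z - y_n|^2.
   The accumulated quadratic is recentred at y_n, where it reads c_n |z - y_n|^2 - 2 <e_n, z - y_n>. *)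
Lemma smooth_variational_principle (X : Hilbert) (D : X -> Prop) (F : X -> R) (p0 : X)
  (B L eps : R) :
  (forall p, (forall eps, 0 < eps -> exists p', D p' /\ hnorm (p' [-] p) < eps) -> D p) ->
  D p0 -> (forall p, D p -> B <= F p) ->
  (forall p q, F p - F q <= L * hnorm (p [-] q)) -> 0 < eps ->
  exists y xi, D y /\ hnorm xi <= eps /\ F y <= F p0 + eps /\
    forall z, D z -> F y + <<xi, z [-] y>> - eps * hnorm (z [-] y) ^ 2 <= F z.
Proof.
  (* [eps] must dominate 19 d for the value, 8 d for |xi| and 2 d for the quadratic coefficient. *)
  intros Dcl D0 HB HL Heps. set (d := eps / 20). assert (Hd : 0 < d) by (unfold d; lra).
  set (I n (s : X * X) := vp_inv X D F p0 d n (fst s) (snd s)).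
  assert (exists s, I 0%nat s) as Hs0.
  { destruct (approx_inf X D F p0 B (d / 2)) as [y [Dy Hy]]; auto; [lra|].
    exists (y, H_zero X). unfold I, vp_inv. simpl.
    assert (E0 : hnorm (H_zero X) = 0) by (unfold hnorm; rewrite inner_0l; apply sqrt_0).
    rewrite E0. split; [auto|split; [lra|split]].
    - specialize (Hy p0 D0). lra.
    - intros z Dz. specialize (Hy z Dz). rewrite inner_0l. lra. }
  (* As an implication the step relation is total, so choice applies to every state, whether or not
     it satisfies the invariant. *)
  set (st (s : nat * (X * X)) (s' : X * X) := I (fst s) (snd s) -> I (S (fst s)) s' /\
     hnorm (fst s' [-] fst (snd s)) <= (/ 2) ^ fst s /\
     hnorm (snd s' [-] snd (snd s)) <= 2 * d * (/ 2) ^ fst s).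
  assert (Hst : forall s, exists s', st s s').
  { intros [n [y e]]. destruct (classic (I n (y, e))) as [H|H].
    - destruct (vp_step X D F p0 d n y e Hd H) as (y' & e' & H'). exists (y', e'). intros _. exact H'.
    - exists (y, e). intros H'. contradiction. }
  set (next s := proj1_sig (constructive_indefinite_description _ (Hst s))).
  set (sq := fix sq n := match n with
             | O => proj1_sig (constructive_indefinite_description _ Hs0)
             | S n => next (n, sq n) end).
  assert (Hn : forall n, I n (sq n) -> st (n, sq n) (sq (S n))).
  { intros n _. change (sq (S n)) with (next (n, sq n)). unfold next.
    apply (proj2_sig (constructive_indefinite_description _ (Hst (n, sq n)))). }
  assert (HI : forall n, I n (sq n)).
  { induction n as [|n IH].
    - apply (proj2_sig (constructive_indefinite_description _ Hs0)).
    - apply (Hn n IH IH). }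
  destruct (geometric_cv X (fun n => fst (sq n)) 1) as [y Hy].
  { intros n. rewrite Rmult_1_l. apply (Hn n (HI n) (HI n)). }
  destruct (geometric_cv X (fun n => snd (sq n)) (2 * d)) as [e He].
  { intros n. apply (Hn n (HI n) (HI n)). }
  assert (Dy : D y).
  { apply Dcl. intros eta Heta. destruct (half_pow_small (eta / 2)) as [N HN]; [lra|].
    exists (fst (sq N)). split; [apply (HI N)|].
    specialize (HN N (le_n N)). specialize (Hy N). simpl in Hy. lra. }
  exists y, (2 [*] e). split; auto. rewrite hnorm_scal by lra. split; [|split].
  - assert (hnorm e - 4 * d <= 0); [|unfold d in *; lra].
    apply (le0_of_half_pow _ (4 * d)). intros n. destruct (HI n) as (_ & H & _).
    specialize (He n). simpl in He. pose proof (half_pow_gt0 n).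
    replace e with (snd (sq n) [-] (snd (sq n) [-] e)) at 1 by vec.
    pose proof (hnorm_tri X (snd (sq n)) (H_zero X) (snd (sq n) [-] e)) as T.
    replace (snd (sq n) [-] H_zero X) with (snd (sq n)) in T by vec.
    replace (H_zero X [-] (snd (sq n) [-] e)) with (e [-] snd (sq n)) in T by vec.
    rewrite (hnorm_subC X e) in T. nra.
  - assert (F y - (F p0 + eps) <= 0); [|lra].
    apply (le0_of_half_pow _ (2 * Rabs L)). intros n. destruct (HI n) as (_ & _ & H & _).
    specialize (HL y (fst (sq n))). rewrite hnorm_subC in HL. specialize (Hy n). simpl in Hy.
    pose proof (half_pow_gt0 n). pose proof (Rle_abs L). pose proof (Rabs_pos L).
    pose proof (hnorm_ge0 X (fst (sq n) [-] y)). unfold d in *. nra.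
  - intros z Dz. rewrite H_innerZl.
    assert (F y + 2 * <<e, z [-] y>> - eps * hnorm (z [-] y) ^ 2 - F z <= 0); [|lra].
    set (N := hnorm (z [-] y)). assert (HN : 0 <= N) by apply hnorm_ge0.
    set (L1 := Rabs L). assert (HL1 : 0 <= L1) by apply Rabs_pos.
    (* The constant collects [A1], [A4], twice [A5], and [A6]: the errors of order [q] made by
       replacing iterates by their limits. *)
    apply (le0_of_half_pow _ (2 * L1 + 2 * d * (4 * N + 4) + 8 * d * (N + 2) + 16 * d + d)).
    intros n. destruct (HI n) as (_ & Ben & _ & H). specialize (H z Dz).
    specialize (Hy n). specialize (He n). simpl in Hy, He.
    specialize (HL y (fst (sq n))). rewrite hnorm_subC in HL.
    set (yn := fst (sq n)) in *. set (en := snd (sq n)) in *.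
    pose proof (half_pow_gt0 n) as Hq. pose proof (half_pow_le1 n) as Hq1. set (q := (/ 2) ^ n) in *.
    pose proof (hnorm_ge0 X (yn [-] y)) as Hpy. pose proof (hnorm_ge0 X (en [-] e)) as Hpe.
    pose proof (hnorm_ge0 X en) as Hpen.
    assert (A1 : F y - F yn <= 2 * L1 * q).
    { pose proof (Rle_abs L) as HLa. fold L1 in HLa. nra. }
    assert (A2 : hnorm (z [-] yn) <= N + 2 * q).
    { pose proof (hnorm_tri X z y yn) as T. rewrite (hnorm_subC X y yn) in T. fold N in T. lra. }
    pose proof (hnorm_ge0 X (z [-] yn)) as Hpz.
    assert (A3 : hnorm (z [-] yn) ^ 2 <= N ^ 2 + (4 * N + 4) * q) by nra.
    assert (A4 : 2 * d * (1 - q) * hnorm (z [-] yn) ^ 2 <= 2 * d * N ^ 2 + 2 * d * (4 * N + 4) * q).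
    { apply Rle_trans with (2 * d * hnorm (z [-] yn) ^ 2).
      - pose proof (pow2_ge_0 (hnorm (z [-] yn))).
        assert (0 <= d * q * hnorm (z [-] yn) ^ 2) by (apply Rmult_le_pos; nra). nra.
      - nra. }
    assert (A5 : <<e, z [-] y>> - <<en, z [-] yn>> <= 4 * d * N * q + 8 * d * q).
    { replace (<<e, z [-] y>> - <<en, z [-] yn>>)
        with (<<en, yn [-] y>> - <<en [-] e, z [-] y>>) by (inner_expand; ring).
      pose proof (inner_le X en (yn [-] y)) as C1. pose proof (inner_ge X (en [-] e) (z [-] y)) as C2.
      fold N in C2.
      assert (hnorm en * hnorm (yn [-] y) <= 8 * d * q).
      { apply Rle_trans with (4 * d * hnorm (yn [-] y)); nra. }
      assert (hnorm (en [-] e) * N <= 4 * d * q * N) by nra. lra. }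
    assert (A6 : d * q ^ 3 / 2 <= d * q).
    { assert (q ^ 3 <= q) by nra. nra. }
    assert (A7 : 2 * d * N ^ 2 <= eps * N ^ 2).
    { pose proof (pow2_ge_0 N). unfold d. nra. }
    assert (0 <= d * N * q) by (apply Rmult_le_pos; nra). assert (0 <= d * q) by nra. nra.
Qed.

(** * Covering properties from a positive coderivative *)

Definition positive_coderivative (X : Hilbert) (T : setmap X) : Prop :=
  forall u v, T u v -> forall w z, reg_coderiv T u v w z -> 0 <= <<z, w>>.

(** Proximal normals are regular: a bound quadratic in the distance is eventually below [eps] times
    the distance. *)
Lemma regular_normal_of_quadratic (X : Hilbert) (Om : X -> X -> Prop) (u v q1 q2 : X) (K : R) :
  (forall a b, Om a b ->
     <<q1, a [-] u>> + <<q2, b [-] v>> <= K * pnorm (a [-] u) (b [-] v) ^ 2) ->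
  regular_normal X Om u v q1 q2.
Proof.
  intros H eps He. pose proof (Rabs_pos K).
  exists (eps / (Rabs K + 1)). split; [apply Rdiv_lt_0_compat; lra|].
  intros a b Hab [P1 P2]. eapply Rle_trans; [apply H, Hab|].
  set (p := pnorm (a [-] u) (b [-] v)) in *.
  apply (Rmult_lt_compat_r (Rabs K + 1)) in P2; [|lra].
  unfold Rdiv in P2. rewrite Rmult_assoc, Rinv_l in P2 by lra.
  pose proof (Rle_abs K). assert (K * p <= eps) by nra. nra.
Qed.

(** Concavity: the square root lies below its tangent at [r ^ 2]. This provides the quadratic upper
    bounds that make a normal proximal. *)
Lemma sqrt_le_tangent (s r : R) : 0 < r -> 0 <= s -> sqrt s <= r + (s - r ^ 2) / (2 * r).
Proof.
  intros Hr Hs. replace (r + (s - r ^ 2) / (2 * r)) with ((s + r ^ 2) / (2 * r)) by (field; lra).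
  apply Rmult_le_reg_r with (2 * r); [lra|].
  unfold Rdiv. rewrite Rmult_assoc, Rinv_l by lra.
  pose proof (sqrt_sqrt s Hs). pose proof (pow2_ge_0 (sqrt s - r)). nra.
Qed.

Lemma sqrt_sq_add_lipschitz (a b t : R) : 0 <= b ->
  sqrt (a ^ 2 + t ^ 2) - sqrt (b ^ 2 + t ^ 2) <= Rabs (a - b).
Proof.
  intros Hb. pose proof (Rabs_pos (a - b)). pose proof (sqrt_pos (b ^ 2 + t ^ 2)).
  assert (E : sqrt (b ^ 2 + t ^ 2) ^ 2 = b ^ 2 + t ^ 2) by (apply pow2_sqrt; nra).
  assert (b <= sqrt (b ^ 2 + t ^ 2)) by (apply sq_le_le; [|rewrite E]; nra).
  assert (sqrt (a ^ 2 + t ^ 2) <= sqrt (b ^ 2 + t ^ 2) + Rabs (a - b)); [|lra].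
  apply sq_le_le; [lra|]. rewrite pow2_sqrt by nra.
  assert (Rabs (a - b) ^ 2 = (a - b) ^ 2) by apply pow2_abs.
  pose proof (Rle_abs (a - b)). nra.
Qed.

Lemma fst_le_pnorm (X : Hilbert) (u v : X) : hnorm u <= pnorm u v.
Proof.
  unfold pnorm. apply sq_le_le; [apply sqrt_pos|].
  pose proof (pow2_ge_0 (hnorm u)). pose proof (pow2_ge_0 (hnorm v)).
  rewrite pow2_sqrt; lra.
Qed.

Lemma snd_le_pnorm (X : Hilbert) (u v : X) : hnorm v <= pnorm u v.
Proof.
  unfold pnorm. apply sq_le_le; [apply sqrt_pos|].
  pose proof (pow2_ge_0 (hnorm u)). pose proof (pow2_ge_0 (hnorm v)).
  rewrite pow2_sqrt; lra.
Qed.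

(* A nonzero residual d = v + lam u - y at an approximate minimizer of
   |v + lam u - y| + mu sqrt (|u - u0|^2 + t^2) over gph T produces a pair z in D^*T(u,v)(w) with
   w close to d / |d| and <z, w> close to at most mu - lam < 0. *)
Lemma residual_zero (X : Hilbert) (T : setmap X) (lam mu t eps : R) (u0 y u v xi1 xi2 : X) :
  positive_coderivative X T -> 0 < mu < lam -> 0 < t -> 0 < eps -> eps <= 1 ->
  eps * (2 + lam + mu) < lam - mu ->
  T u v -> hnorm xi1 <= eps -> hnorm xi2 <= eps ->
  (forall a b, T a b ->
     hnorm (v [+] lam [*] u [-] y) + mu * sqrt (hnorm (u [-] u0) ^ 2 + t ^ 2)
     + (<<xi1, a [-] u>> + <<xi2, b [-] v>>) - eps * pnorm (a [-] u) (b [-] v) ^ 2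
     <= hnorm (b [+] lam [*] a [-] y) + mu * sqrt (hnorm (a [-] u0) ^ 2 + t ^ 2)) ->
  v [+] lam [*] u = y.
Proof.
  intros Hpos Hmu Ht He He1 Hsmall Huv Hx1 Hx2 Hmin.
  destruct (classic (v [+] lam [*] u = y)) as [|N]; auto. exfalso.
  apply hnorm_gt0 in N. set (d := v [+] lam [*] u [-] y) in *. set (rho := hnorm d) in *.
  assert (Ed : rho ^ 2 = <<d, d>>) by apply hnorm_sq.
  pose proof (pow2_ge_0 (hnorm (u [-] u0))) as Hsq.
  set (s := sqrt (hnorm (u [-] u0) ^ 2 + t ^ 2)) in *.
  assert (Es : s ^ 2 = hnorm (u [-] u0) ^ 2 + t ^ 2) by (apply pow2_sqrt; nra).
  assert (Hs : 0 < s) by (apply sqrt_lt_R0; nra).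
  (* Gradients of the two terms of the objective: [e] of the norm at the residual [d], [k] of the
     smoothed distance at [u]. *)
  set (e := (/ rho) [*] d). set (k := (mu / s) [*] (u [-] u0)).
  assert (Ee : hnorm e = 1).
  { unfold e. rewrite hnorm_scal by (left; apply Rinv_0_lt_compat; lra). fold rho. field. lra. }
  assert (Ek : hnorm k <= mu).
  { unfold k. pose proof (hnorm_ge0 X (u [-] u0)).
    rewrite hnorm_scal by (left; apply Rdiv_lt_0_compat; lra).
    assert (hnorm (u [-] u0) <= s) by (apply sq_le_le; nra).
    apply Rmult_le_reg_r with s; auto.
    replace (mu / s * hnorm (u [-] u0) * s) with (mu * hnorm (u [-] u0)) by (field; lra). nra. }
  (* The normal to the graph is (xi1, xi2) minus the gradient (lam e + k, e) of the objective; its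
     second component is - w with w = e - xi2. *)
  assert (P : 0 <= <<(xi1 [-] lam [*] e) [-] k, e [-] xi2>>).
  { apply (Hpos u v Huv). unfold reg_coderiv.
    (* [eps] comes from the variational inequality, the other two terms from the tangent bounds at
       [rho] and [s]. *)
    apply regular_normal_of_quadratic
      with (K := eps + (1 + lam) ^ 2 / (2 * rho) + mu / (2 * s)).
    intros a b Hab. specialize (Hmin a b Hab).
    set (p := pnorm (a [-] u) (b [-] v)) in *.
    pose proof (fst_le_pnorm X (a [-] u) (b [-] v)) as Pa. fold p in Pa.
    pose proof (snd_le_pnorm X (a [-] u) (b [-] v)) as Pb. fold p in Pb.
    pose proof (hnorm_ge0 X (a [-] u)) as Pa0. pose proof (hnorm_ge0 X (b [-] v)) as Pb0.
    set (g := (b [-] v) [+] lam [*] (a [-] u)).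
    assert (Hg : hnorm g ^ 2 <= (1 + lam) ^ 2 * p ^ 2).
    { assert (hnorm g <= (1 + lam) * p).
      { unfold g. eapply Rle_trans; [apply hnorm_add|]. rewrite hnorm_scal by lra. nra. }
      pose proof (hnorm_ge0 X g). rewrite <- Rpow_mult_distr. apply pow_incr. lra. }
    assert (B1 : hnorm (b [+] lam [*] a [-] y) <= rho + <<e, g>> + (1 + lam) ^ 2 / (2 * rho) * p ^ 2).
    { replace (b [+] lam [*] a [-] y) with (d [+] g) by (unfold d, g; vec).
      unfold hnorm at 1. eapply Rle_trans; [apply (sqrt_le_tangent _ rho); [auto|apply H_inner_ge0]|].
      rewrite Ed.
      replace (<<d [+] g, d [+] g>> - <<d, d>>) with (2 * <<d, g>> + hnorm g ^ 2)
        by (rewrite hnorm_sq; inner_expand; ring).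
      unfold e. rewrite H_innerZl.
      replace ((2 * <<d, g>> + hnorm g ^ 2) / (2 * rho))
        with (/ rho * <<d, g>> + hnorm g ^ 2 * / (2 * rho)) by (field; lra).
      replace ((1 + lam) ^ 2 / (2 * rho) * p ^ 2) with ((1 + lam) ^ 2 * p ^ 2 * / (2 * rho))
        by (field; lra).
      assert (0 < / (2 * rho)) by (apply Rinv_0_lt_compat; lra). nra. }
    assert (B2 : mu * sqrt (hnorm (a [-] u0) ^ 2 + t ^ 2)
                 <= mu * s + <<k, a [-] u>> + mu / (2 * s) * p ^ 2).
    { apply Rle_trans with (mu * (s + (hnorm (a [-] u0) ^ 2 + t ^ 2 - s ^ 2) / (2 * s))).
      { apply Rmult_le_compat_l; [lra|]. apply sqrt_le_tangent; auto.
        pose proof (pow2_ge_0 (hnorm (a [-] u0))). nra. }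
      rewrite Es.
      replace (hnorm (a [-] u0) ^ 2 + t ^ 2 - (hnorm (u [-] u0) ^ 2 + t ^ 2))
        with (2 * <<u [-] u0, a [-] u>> + hnorm (a [-] u) ^ 2)
        by (rewrite !hnorm_sq; inner_expand; ring).
      unfold k. rewrite H_innerZl.
      assert (Hp : hnorm (a [-] u) ^ 2 <= p ^ 2) by (apply pow_incr; lra).
      assert (0 < mu / (2 * s)) by (apply Rdiv_lt_0_compat; lra).
      replace (mu * (s + (2 * <<u [-] u0, a [-] u>> + hnorm (a [-] u) ^ 2) / (2 * s)))
        with (mu * s + mu / s * <<u [-] u0, a [-] u>> + mu / (2 * s) * hnorm (a [-] u) ^ 2)
        by (field; lra).
      nra. }
    assert (B3 : <<(xi1 [-] lam [*] e) [-] k, a [-] u>> + <<H_opp X (e [-] xi2), b [-] v>>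
                 = <<xi1, a [-] u>> + <<xi2, b [-] v>> - <<e, g>> - <<k, a [-] u>>)
      by (unfold g; clearbody e k; inner_expand; ring).
    rewrite B3. lra. }
  replace (<<(xi1 [-] lam [*] e) [-] k, e [-] xi2>>)
    with (<<xi1, e>> - <<xi1, xi2>> - lam * <<e, e>> + lam * <<e, xi2>> - <<k, e>> + <<k, xi2>>) in P
    by (clearbody e k; inner_expand; ring).
  rewrite <- hnorm_sq, Ee in P.
  pose proof (inner_le X xi1 e) as C1. pose proof (inner_ge X xi1 xi2) as C2.
  pose proof (inner_le X e xi2) as C3. pose proof (inner_ge X k e) as C4.
  pose proof (inner_le X k xi2) as C5. rewrite Ee in C1, C3, C4.
  pose proof (hnorm_ge0 X xi1). pose proof (hnorm_ge0 X xi2). pose proof (hnorm_ge0 X k).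
  (* Altogether <z, w> <= eps (2 + lam + mu) - (lam - mu) < 0. *)
  assert (hnorm xi1 * hnorm xi2 <= eps) by nra.
  assert (hnorm k * hnorm xi2 <= mu * eps) by nra.
  nra.
Qed.

(** The approximate minimizer has zero residual by [residual_zero], so comparing its objective value
    with the one at [(u0, v0)] leaves only the weighted distance on the left. *)
Lemma coderivative_covering (X : Hilbert) (T : setmap X) (lam mu eta : R) (u0 v0 y : X) :
  closed_graph T -> positive_coderivative X T -> 0 < mu < lam -> 0 < eta -> T u0 v0 ->
  exists u v, T u v /\ v [+] lam [*] u = y /\
    mu * hnorm (u [-] u0) <= hnorm (v0 [+] lam [*] u0 [-] y) + eta.
Proof.
  intros Hcl Hpos Hmu Heta H0.
  (* Smoothing adds mu t = eta / 2 at [u0]; the other half of [eta] absorbs [eps]. *)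
  set (t := eta / (2 * mu)).
  assert (Ht : 0 < t) by (apply Rdiv_lt_0_compat; lra).
  assert (Emt : mu * t = eta / 2) by (unfold t; field; lra).
  set (eps := Rmin (Rmin 1 (eta / 2)) ((lam - mu) / (2 * (2 + lam + mu)))).
  assert (He3 : 0 < (lam - mu) / (2 * (2 + lam + mu))) by (apply Rdiv_lt_0_compat; lra).
  assert (He : 0 < eps) by (unfold eps; repeat apply Rmin_glb_lt; lra).
  assert (He1 : eps <= 1 /\ eps <= eta / 2).
  { unfold eps. pose proof (Rmin_l (Rmin 1 (eta / 2)) ((lam - mu) / (2 * (2 + lam + mu)))).
    pose proof (Rmin_l 1 (eta / 2)). pose proof (Rmin_r 1 (eta / 2)). lra. }
  assert (He2 : eps * (2 + lam + mu) < lam - mu).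
  { assert (eps <= (lam - mu) / (2 * (2 + lam + mu))) as L by apply Rmin_r.
    apply (Rmult_le_compat_r (2 + lam + mu)) in L; [|lra].
    replace ((lam - mu) / (2 * (2 + lam + mu)) * (2 + lam + mu)) with ((lam - mu) / 2) in L
      by (field; lra). lra. }
  set (F (p : prodH X) := hnorm (snd p [+] lam [*] fst p [-] y)
                          + mu * sqrt (hnorm (fst p [-] u0) ^ 2 + t ^ 2)).
  destruct (smooth_variational_principle (prodH X) (fun p => T (fst p) (snd p)) F (u0, v0) 0
              (1 + lam + mu) eps) as [[u v] [[xi1 xi2] (Huv & Hxi & HF & Hmin)]]; auto.
  - intros [a b] H. apply Hcl. intros e' He'. destruct (H e' He') as [[a' b'] [Hab' L]].
    exists a', b'. split; auto. rewrite pnorm_hnorm. exact L.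
  - intros p _. apply Rplus_le_le_0_compat; [apply hnorm_ge0|].
    apply Rmult_le_pos; [lra|apply sqrt_pos].
  - intros [a b] [a' b']. unfold F; simpl fst; simpl snd.
    replace (@hnorm (prodH X) (@hsub (prodH X) (a, b) (a', b'))) with (pnorm (a [-] a') (b [-] b'))
      by (rewrite pnorm_hnorm; reflexivity).
    pose proof (fst_le_pnorm X (a [-] a') (b [-] b')) as Pa.
    pose proof (snd_le_pnorm X (a [-] a') (b [-] b')) as Pb.
    assert (A1 : hnorm (b [+] lam [*] a [-] y) - hnorm (b' [+] lam [*] a' [-] y)
                 <= hnorm (b [-] b') + lam * hnorm (a [-] a')).
    { replace (b [+] lam [*] a [-] y)
        with (((b [-] b') [+] lam [*] (a [-] a')) [+] (b' [+] lam [*] a' [-] y)) by vec.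
      pose proof (hnorm_add X ((b [-] b') [+] lam [*] (a [-] a')) (b' [+] lam [*] a' [-] y)).
      pose proof (hnorm_add X (b [-] b') (lam [*] (a [-] a'))) as H1.
      rewrite hnorm_scal in H1 by lra. lra. }
    assert (A2 : sqrt (hnorm (a [-] u0) ^ 2 + t ^ 2) - sqrt (hnorm (a' [-] u0) ^ 2 + t ^ 2)
                 <= hnorm (a [-] a')).
    { eapply Rle_trans; [apply sqrt_sq_add_lipschitz, hnorm_ge0|]. apply Rabs_le.
      pose proof (hnorm_tri X a a' u0). pose proof (hnorm_tri X a' a u0) as H2.
      rewrite (hnorm_subC X a' a) in H2. lra. }
    pose proof (hnorm_ge0 X (a [-] a')). nra.
  - simpl in Huv. simpl fst in *; simpl snd in *.
    replace (@hnorm (prodH X) (xi1, xi2)) with (pnorm xi1 xi2) in Hxi by apply pnorm_hnorm.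
    pose proof (fst_le_pnorm X xi1 xi2). pose proof (snd_le_pnorm X xi1 xi2).
    exists u, v. split; auto.
    assert (E : v [+] lam [*] u = y).
    { apply (residual_zero X T lam mu t eps u0 y u v xi1 xi2); auto; try lra.
      intros a b Hab. specialize (Hmin (a, b) Hab).
      replace (@hnorm (prodH X) (@hsub (prodH X) (a, b) (u, v))) with (pnorm (a [-] u) (b [-] v))
        in Hmin by (rewrite pnorm_hnorm; reflexivity).
      exact Hmin. }
    split; auto. unfold F in HF. simpl fst in HF; simpl snd in HF.
    replace (u0 [-] u0) with (0 [*] u0) in HF by vec. rewrite (hnorm_scal X 0) in HF by lra.
    replace ((0 * hnorm u0) ^ 2 + t ^ 2) with (t ^ 2) in HF by ring.
    rewrite sqrt_pow2 in HF by lra.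
    pose proof (hnorm_ge0 X (v [+] lam [*] u [-] y)).
    assert (hnorm (u [-] u0) <= sqrt (hnorm (u [-] u0) ^ 2 + t ^ 2)).
    { rewrite <- (sqrt_pow2 (hnorm (u [-] u0))) at 1 by apply hnorm_ge0.
      apply sqrt_le_1_alt. nra. }
    nra.
Qed.

(** * Local monotonicity and its extension along segments *)

Lemma hypomonotone_locally_monotone (X : Hilbert) (T : setmap X) (ub : X) :
  closed_graph T -> positive_coderivative X T -> semilocally_hypomonotone_at T ub ->
  exists delta, 0 < delta /\ forall u1 v1 u2 v2, T u1 v1 -> T u2 v2 ->
    hnorm (u1 [-] ub) < delta -> hnorm (u2 [-] ub) < delta -> 0 <= <<v1 [-] v2, u1 [-] u2>>.
Proof.
  intros Hcl Hpos (_ & U & r & (delta & Hd & HU) & Hr & Hhyp).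
  (* The solution [u] found below is within [3 * delta / 4] of [u1], hence still in the ball where
     hypomonotonicity holds. *)
  exists (delta / 4). split; [lra|]. intros u1 v1 u2 v2 H1 H2 L1 L2.
  set (a := u2 [-] u1). set (b := v2 [-] v1).
  assert (Ha : hnorm a < delta / 2).
  { unfold a. pose proof (hnorm_tri X u2 ub u1) as T1. rewrite (hnorm_subC X ub u1) in T1. lra. }
  pose proof (hnorm_ge0 X a) as Ha0. pose proof (hnorm_ge0 X b) as Hb0.
  set (lam0 := r + 16 * (hnorm b + 1) / delta).
  assert (Hl0 : r < lam0).
  { unfold lam0. assert (0 < 16 * (hnorm b + 1) / delta) by (apply Rdiv_lt_0_compat; lra). lra. }
  assert (Key : forall lam, lam0 < lam -> lam * hnorm a <= hnorm (b [+] lam [*] a)).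
  { intros lam Hlam.
    assert (Hlb : 16 * (hnorm b + 1) < lam * delta).
    { replace (16 * (hnorm b + 1)) with (16 * (hnorm b + 1) / delta * delta) by (field; lra).
      apply Rmult_lt_compat_r; auto. unfold lam0 in Hlam. lra. }
    apply le_epsilon. intros eps He.
    set (eta := Rmin 1 (eps / 2)).
    assert (Heta : 0 < eta <= 1 /\ eta <= eps / 2).
    { unfold eta. pose proof (Rmin_l 1 (eps / 2)). pose proof (Rmin_r 1 (eps / 2)).
      repeat split; auto. apply Rmin_glb_lt; lra. }
    (* The first bound keeps the rate [lam - kap] above 3 lam / 4, the second makes the loss kap |a|
       at most eps / 2. *)
    set (kap := Rmin (lam / 4) (eps / (2 * (hnorm a + 1)))).
    assert (Hq : 0 < eps / (2 * (hnorm a + 1))) by (apply Rdiv_lt_0_compat; lra).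
    assert (Hk : 0 < kap <= lam / 4 /\ kap * hnorm a <= eps / 2).
    { unfold kap. pose proof (Rmin_l (lam / 4) (eps / (2 * (hnorm a + 1)))) as M1.
      pose proof (Rmin_r (lam / 4) (eps / (2 * (hnorm a + 1)))) as M2.
      assert (0 < Rmin (lam / 4) (eps / (2 * (hnorm a + 1)))) as M0 by (apply Rmin_glb_lt; lra).
      repeat split; auto.
      apply (Rmult_le_compat_r (hnorm a + 1)) in M2; [|lra].
      replace (eps / (2 * (hnorm a + 1)) * (hnorm a + 1)) with (eps / 2) in M2 by (field; lra).
      nra. }
    (* Covering started at [(u1, v1)], with the target already attained at [(u2, v2)]. *)
    destruct (coderivative_covering X T lam (lam - kap) eta u1 v1 (v2 [+] lam [*] u2))
      as (u & v & Huv & E & L); auto; try lra.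
    replace (v1 [+] lam [*] u1 [-] (v2 [+] lam [*] u2)) with
      (H_zero X [-] (b [+] lam [*] a)) in L by (unfold a, b; vec).
    rewrite (hnorm_subC X (H_zero X)) in L.
    replace ((b [+] lam [*] a) [-] H_zero X) with (b [+] lam [*] a) in L by vec.
    assert (Eu : u = u2).
    { pose proof (hnorm_add X b (lam [*] a)) as T1. rewrite hnorm_scal in T1 by lra.
      assert (D1 : hnorm (u [-] u1) < 3 * delta / 4).
      { apply Rmult_lt_reg_l with (lam - kap); [lra|].
        assert (lam * hnorm a <= lam * (delta / 2)) by (apply Rmult_le_compat_l; lra).
        assert (kap * delta <= lam / 4 * delta) by (apply Rmult_le_compat_r; lra). lra. }
      assert (D2 : hnorm (u [-] ub) < delta).
      { pose proof (hnorm_tri X u u1 ub). lra. }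
      (* Equal targets give v - v2 = - lam (u - u2); hypomonotonicity with lam > r then forces u =
         u2. *)
      specialize (Hhyp u v u2 v2 Huv H2 (HU u D2) (HU u2 ltac:(lra))).
      apply hilbert_eq.
      replace v with (v2 [+] lam [*] u2 [-] lam [*] u) in Hhyp by (rewrite <- E; vec).
      replace (<<v2 [+] lam [*] u2 [-] lam [*] u [-] v2, u [-] u2>>)
        with (- lam * <<u [-] u2, u [-] u2>>) in Hhyp by (inner_expand; ring).
      rewrite hnorm_sq in Hhyp. pose proof (H_inner_ge0 X (u [-] u2)). nra. }
    subst u. fold a in L. lra. }
  assert (Hin : 0 <= <<b, a>>).
  { apply Rnot_lt_le. intros N.
    (* For lam > x the quantity |b|^2 + 2 lam <b, a> is negative, against the square of [Key]. *)
    set (x := hnorm b ^ 2 / (- <<b, a>>)).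
    assert (P : 0 <= x).
    { apply Rmult_le_pos; [apply pow2_ge_0|]. left. apply Rinv_0_lt_compat. lra. }
    assert (Q : x * (- <<b, a>>) = hnorm b ^ 2) by (unfold x; field; lra).
    specialize (Key (lam0 + 1 + x) ltac:(lra)).
    set (lam := lam0 + 1 + x) in *.
    assert (S : (lam * hnorm a) ^ 2 <= hnorm (b [+] lam [*] a) ^ 2).
    { apply pow_incr. split; auto. apply Rmult_le_pos; auto. unfold lam; lra. }
    rewrite Rpow_mult_distr, !hnorm_sq in S.
    replace (<<b [+] lam [*] a, b [+] lam [*] a>>)
      with (hnorm b ^ 2 + 2 * lam * <<b, a>> + lam ^ 2 * <<a, a>>) in S
      by (rewrite hnorm_sq; clearbody a b; inner_expand; ring).
    assert (x * (- <<b, a>>) < lam * (- <<b, a>>)) by (apply Rmult_lt_compat_r; unfold lam; lra).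
    assert (0 <= x * (- <<b, a>>)) by (apply Rmult_le_pos; lra). lra. }
  replace (<<v1 [-] v2, u1 [-] u2>>) with (<<b, a>>) by (unfold a, b; inner_expand; ring).
  exact Hin.
Qed.

(* The largest s with M 0 s is 1: local comparability pushes past any smaller supremum. *)
Lemma unit_interval_chain (M : R -> R -> Prop) :
  (forall r s t, 0 <= r <= 1 -> 0 <= s <= 1 -> 0 <= t <= 1 -> M r s -> M s t -> M r t) ->
  (forall s, 0 <= s <= 1 -> exists delta, 0 < delta /\
     forall r t, 0 <= r <= 1 -> 0 <= t <= 1 -> s - delta < r -> r < t -> t < s + delta -> M r t) ->
  M 0 1.
Proof.
  intros Htr Hloc.
  (* The point 0 is added by hand, since local comparability only covers r < t. *)
  set (E t := 0 <= t <= 1 /\ (t = 0 \/ M 0 t)).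
  destruct (completeness E) as [s [Hs1 Hs2]].
  { exists 1. intros t [[_ H] _]. exact H. }
  { exists 0. split; [lra|auto]. }
  assert (Hs0 : 0 <= s) by (apply Hs1; split; [lra|auto]).
  assert (Hs1' : s <= 1) by (apply Hs2; intros t [[_ H] _]; exact H).
  destruct (Hloc s (conj Hs0 Hs1')) as (delta & Hd & HM).
  assert (exists t, E t /\ s - delta < t) as (t & [Ht HEt] & Lt).
  { apply NNPP. intros N. assert (s <= s - delta); [|lra]. apply Hs2.
    intros t Et. apply Rnot_lt_le. intros L. apply N. exists t. auto. }
  assert (Lts : t <= s) by (apply Hs1; split; auto).
  set (t' := Rmin 1 (s + delta / 2)).
  assert (Ht' : t <= t' <= 1 /\ t' <= s + delta / 2).
  { unfold t'. pose proof (Rmin_l 1 (s + delta / 2)). pose proof (Rmin_r 1 (s + delta / 2)).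
    repeat split; auto. apply Rmin_glb; lra. }
  assert (Et' : E t').
  { split; [lra|]. destruct (Req_dec t t') as [Q|Q]; [rewrite <- Q; exact HEt|].
    assert (M t t') as Mt by (apply HM; lra).
    right. destruct HEt as [Z|M0]; [rewrite <- Z; exact Mt|].
    apply (Htr 0 t t'); auto; lra. }
  assert (L' : t' <= s) by (apply Hs1; exact Et').
  assert (t' = 1) as E1.
  { unfold t' in *. destruct (Rle_dec 1 (s + delta / 2)) as [Q|Q];
      [apply Rmin_left; exact Q|rewrite Rmin_right in L' by lra; lra]. }
  destruct Et' as [_ [Z|M0]]; [lra|]. rewrite E1 in M0. exact M0.
Qed.

(** The relation between parameters r and t that all values at [p t] dominate those at [p r] in
    direction [d] is transitive: convexity of the domain provides a value at each intermediate
    point. It holds locally, hence from 0 to 1. *)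
Lemma locally_monotone_monotone (X : Hilbert) (T : setmap X) :
  convex (dom T) ->
  (forall ub, dom T ub -> exists delta, 0 < delta /\ forall u1 v1 u2 v2, T u1 v1 -> T u2 v2 ->
    hnorm (u1 [-] ub) < delta -> hnorm (u2 [-] ub) < delta -> 0 <= <<v1 [-] v2, u1 [-] u2>>) ->
  monotone T.
Proof.
  intros Hconv Hloc u1 v1 u2 v2 H1 H2.
  set (d := u1 [-] u2). set (p s := s [*] u1 [+] (1 - s) [*] u2).
  assert (Hp : forall s, 0 <= s <= 1 -> dom T (p s)).
  { intros s Hs. apply Hconv; auto; [exists v1|exists v2]; auto. }
  assert (Ep : forall r s, p r [-] p s = (r - s) [*] d) by (intros; unfold p, d; vec).
  assert (M : forall w w', T (p 0) w -> T (p 1) w' -> 0 <= <<w' [-] w, d>>).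
  { apply (unit_interval_chain (fun r t => forall w w', T (p r) w -> T (p t) w' -> 0 <= <<w' [-] w, d>>)).
    - intros r s t Hr Hs Ht A B w w' Hw Hw'. destruct (Hp s Hs) as [w'' Hw''].
      specialize (A w w'' Hw Hw''). specialize (B w'' w' Hw'' Hw').
      replace (w' [-] w) with ((w' [-] w'') [+] (w'' [-] w)) by vec. rewrite H_innerDl. lra.
    - intros s Hs. destruct (Hloc (p s) (Hp s Hs)) as (del & Hdel & HM).
      pose proof (hnorm_ge0 X d) as Hd0.
      exists (del / (hnorm d + 1)). split; [apply Rdiv_lt_0_compat; lra|].
      assert (Near : forall r, Rabs (r - s) < del / (hnorm d + 1) -> hnorm (p r [-] p s) < del).
      { intros r Hr. assert (hnorm (p r [-] p s) = Rabs (r - s) * hnorm d) as ->.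
        { destruct (Rle_lt_dec 0 (r - s)) as [Q|Q].
          - rewrite Ep, hnorm_scal, Rabs_right; lra.
          - rewrite hnorm_subC, Ep, hnorm_scal, Rabs_left; lra. }
        apply (Rmult_lt_compat_r (hnorm d + 1)) in Hr; [|lra].
        replace (del / (hnorm d + 1) * (hnorm d + 1)) with del in Hr by (field; lra).
        pose proof (Rabs_pos (r - s)). nra. }
      intros r t Hr Ht L1 L2 L3 w w' Hw Hw'.
      assert (P : 0 <= <<w' [-] w, p t [-] p r>>).
      { apply HM; auto; apply Near; apply Rabs_def1; lra. }
      rewrite Ep, inner_Zr in P. apply Rmult_le_reg_l with (t - r); lra. }
  unfold d in M. apply M.
  - replace (p 0) with u2; auto. unfold p. vec.
  - replace (p 1) with u1; auto. unfold p. vec.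
Qed.

(** * Maximality and surjectivity of T + I *)

(** A pair of the extension and the pair of [T] with the same sum satisfy v - v' = -(u - u'), so
    monotonicity forces them to coincide. *)
Lemma monotone_onto_maximal (X : Hilbert) (T : setmap X) :
  monotone T -> (forall y, exists u v, T u v /\ v [+] u = y) -> maximal_monotone T.
Proof.
  intros Hm Honto. split; auto. intros S HS HTS u v Huv.
  destruct (Honto (v [+] u)) as (u' & v' & H' & E).
  pose proof (HS u v u' v' Huv (HTS u' v' H')) as P.
  assert (Ev : v' = v [+] u [-] u') by (rewrite <- E; vec).
  assert (Eu : u' = u).
  { apply hilbert_eq. rewrite Ev in P.
    replace (<<v [-] (v [+] u [-] u'), u [-] u'>>) with (- <<u' [-] u, u' [-] u>>) in P
      by (inner_expand; ring).
    pose proof (H_inner_ge0 X (u' [-] u)). lra. }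
  subst u'. replace v with v'; auto. rewrite Ev. vec.
Qed.

(* Minimizing s + |p|^2 / 2 over the epigraph of the supremum of the affine functions <a, .> - b:
   by strong convexity minimizing sequences are Cauchy, and p0 satisfies the variational
   inequality of the minimum. *)
Lemma affine_sup_prox (X : Hilbert) (A : X -> R -> Prop) (p1 : X) (s1 : R) :
  (forall a b, A a b -> <<a, p1>> - b <= s1) ->
  (forall p s, (forall a b, A a b -> <<a, p>> - b <= s) -> 0 <= s + <<p, p>> / 2) ->
  exists p0 s0, (forall a b, A a b -> <<a, p0>> - b <= s0) /\
    forall p s, (forall a b, A a b -> <<a, p>> - b <= s) -> s0 + <<p0, p0>> <= s + <<p0, p>>.
Proof.
  intros Hfeas Hbd.
  set (Fe (p : X) s := forall a b, A a b -> <<a, p>> - b <= s) in *.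
  set (val (p : X) s := s + <<p, p>> / 2).
  assert (Hcvx : forall p s p' s' t, 0 <= t <= 1 -> Fe p s -> Fe p' s' ->
            Fe ((1 - t) [*] p [+] t [*] p') ((1 - t) * s + t * s')).
  { intros p s p' s' t Ht H H' a b Hab. specialize (H a b Hab). specialize (H' a b Hab).
    rewrite inner_Dr, !inner_Zr. nra. }
  destruct (completeness (fun m => exists p s, Fe p s /\ m = - val p s)) as [m [Hm1 Hm2]].
  { exists 0. intros m (p & s & H & ->). specialize (Hbd p s H). unfold val. lra. }
  { exists (- val p1 s1), p1, s1. auto. }
  set (mu := - m).
  assert (Hmu : forall p s, Fe p s -> mu <= val p s).
  { intros p s H. specialize (Hm1 (- val p s) (ex_intro _ p (ex_intro _ s (conj H eq_refl)))).
    unfold mu. lra. }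
  (* With tolerance q^2 / 8, the midpoint identity for [val] puts consecutive points at most q
     apart. *)
  assert (Hex : forall n : nat, exists ps : X * R,
            Fe (fst ps) (snd ps) /\ val (fst ps) (snd ps) <= mu + ((/ 2) ^ n) ^ 2 / 8).
  { intros n. apply NNPP. intros N.
    assert (Hq : 0 < ((/ 2) ^ n) ^ 2) by (apply pow_lt, half_pow_gt0).
    assert (m <= m - ((/ 2) ^ n) ^ 2 / 8); [|lra].
    apply Hm2. intros x (p & s & H & ->). apply Rnot_lt_le. intros L. apply N.
    exists (p, s). simpl fst; simpl snd. split; auto. unfold mu. lra. }
  set (ps n := proj1_sig (constructive_indefinite_description _ (Hex n))).
  assert (Hps : forall n, Fe (fst (ps n)) (snd (ps n)) /\
            val (fst (ps n)) (snd (ps n)) <= mu + ((/ 2) ^ n) ^ 2 / 8)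
    by (intros n; apply (proj2_sig (constructive_indefinite_description _ (Hex n)))).
  destruct (geometric_cv X (fun n => fst (ps n)) 1) as [p0 Hp0].
  { intros n. destruct (Hps n) as [F0 V0]. destruct (Hps (S n)) as [F1 V1].
    destruct (ps n) as [p s]. destruct (ps (S n)) as [p' s']. simpl fst in *; simpl snd in *.
    change ((/ 2) ^ S n) with (/ 2 * (/ 2) ^ n) in V1.
    pose proof (half_pow_gt0 n) as Hq. set (q := (/ 2) ^ n) in *.
    rewrite Rmult_1_l. apply sq_le_le; [lra|].
    pose proof (Hmu _ _ (Hcvx p s p' s' (/ 2) ltac:(lra) F0 F1)) as V.
    assert (E : val ((1 - / 2) [*] p [+] / 2 [*] p') ((1 - / 2) * s + / 2 * s')
                = (val p s + val p' s') / 2 - hnorm (p' [-] p) ^ 2 / 8)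
      by (unfold val; rewrite hnorm_sq; inner_expand; field).
    rewrite E in V. nra. }
  simpl in Hp0.
  (* The height at which [val p0 s0] equals the infimum [mu]. *)
  set (s0 := mu - <<p0, p0>> / 2).
  assert (F0 : Fe p0 s0).
  { intros a b Hab. assert (<<a, p0>> - b - s0 <= 0); [|lra].
    apply (le0_of_half_pow _ (2 * hnorm a + 2 * hnorm p0 + 1)). intros n.
    destruct (Hps n) as [Hf Hv]. specialize (Hf a b Hab). specialize (Hp0 n).
    destruct (ps n) as [p s]. simpl fst in *; simpl snd in *. unfold val in Hv. unfold s0.
    pose proof (half_pow_gt0 n) as Hq. pose proof (half_pow_le1 n) as Hq1.
    set (q := (/ 2) ^ n) in *.
    assert (E1 : <<a, p0>> = <<a, p>> - <<a, p [-] p0>>) by (inner_expand; ring).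
    assert (E2 : <<p, p>> = <<p0, p0>> + 2 * <<p0, p [-] p0>> + <<p [-] p0, p [-] p0>>)
      by (inner_expand; ring).
    pose proof (inner_ge X a (p [-] p0)) as C1. pose proof (inner_ge X p0 (p [-] p0)) as C2.
    pose proof (H_inner_ge0 X (p [-] p0)). pose proof (hnorm_ge0 X a). pose proof (hnorm_ge0 X p0).
    assert (hnorm a * hnorm (p [-] p0) <= hnorm a * (2 * q)) by (apply Rmult_le_compat_l; lra).
    assert (hnorm p0 * hnorm (p [-] p0) <= hnorm p0 * (2 * q)) by (apply Rmult_le_compat_l; lra).
    assert (q ^ 2 <= q) by nra. lra. }
  exists p0, s0. split; auto. intros p s H. apply Rnot_lt_le. intros L.
  set (g := s0 + <<p0, p0>> - (s + <<p0, p>>)). assert (Hg : 0 < g) by (unfold g; lra).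
  set (w := <<p [-] p0, p [-] p0>>). assert (Hw : 0 <= w) by apply H_inner_ge0.
  (* A step with t w < g: the first-order gain t g exceeds t^2 w / 2, so [val] would drop below
     [mu]. *)
  set (t := g / (g + w)).
  assert (Et : t * (g + w) = g) by (unfold t; field; lra).
  assert (Ht : 0 < t) by (apply Rdiv_lt_0_compat; lra).
  assert (Ht1 : t <= 1) by nra.
  pose proof (Hmu _ _ (Hcvx p0 s0 p s t ltac:(lra) F0 H)) as V.
  assert (E : val ((1 - t) [*] p0 [+] t [*] p) ((1 - t) * s0 + t * s)
              = mu - t * g + t ^ 2 * w / 2)
    by (unfold val, g, w, s0; clearbody t; inner_expand; field).
  rewrite E in V. assert (t * (g - t * w / 2) <= 0) by lra.
  assert (t * w < g) by nra. nra.
Qed.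

(* Minty's theorem; the supremum is the Fitzpatrick function of T. *)
Lemma maximal_monotone_zero (X : Hilbert) (T : setmap X) :
  proper T -> maximal_monotone T -> exists u, T u (H_opp X u).
Proof.
  intros [y1 [z1 H1]] [Hmon Hmax].
  (* Maximality in pointwise form: a pair monotonically related to the whole graph can be adjoined
     to it. *)
  assert (Hrel : forall u v, (forall y z, T y z -> 0 <= <<v [-] z, u [-] y>>) -> T u v).
  { intros u v H. apply (Hmax (fun a b => T a b \/ (a = u /\ b = v))); auto.
    intros a b a' b' [Hab|[-> ->]] [Hab'|[-> ->]].
    - apply Hmon; auto.
    - specialize (H a b Hab). replace (<<b [-] v, a [-] u>>) with (<<v [-] b, u [-] a>>)
        by (inner_expand; ring). exact H.
    - apply H; auto.
    - replace (v [-] v) with (0 [*] v) by vec. rewrite H_innerZl. lra. }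
  (* Coordinates are swapped: the pair (y, z) of the graph contributes (u, v) |-> <z, u> + <y, v> -
     <y, z>. *)
  set (A (p : prodH X) (b : R) := T (snd p) (fst p) /\ b = <<snd p, fst p>>).
  (* The Fitzpatrick function is at least <u, v>: a smaller value would put (u, v) in the graph,
     whose own affine function equals <u, v> there. *)
  assert (Hfitz : forall (p : prodH X) s, (forall a b, A a b -> H_inner (prodH X) a p - b <= s) ->
            <<fst p, snd p>> <= s).
  { intros [u v] s H. simpl. apply Rnot_lt_le. intros L.
    assert (Tuv : T u v).
    { apply Hrel. intros y z Hyz. specialize (H (z, y) (<<y, z>>) (conj Hyz eq_refl)).
      simpl in H. revert H L. inner_expand. lra. }
    specialize (H (v, u) (<<u, v>>) (conj Tuv eq_refl)). simpl in H.
    rewrite (H_innerC X v u) in H. lra. }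
  destruct (affine_sup_prox (prodH X) A (y1, z1) (<<y1, z1>>)) as [[u v] [s [Hs Hvar]]].
  { intros [z y] b [Hyz ->]. simpl in *. specialize (Hmon y1 z1 y z H1 Hyz).
    revert Hmon. inner_expand. lra. }
  { intros [a b] s H. apply Hfitz in H. simpl in *.
    pose proof (H_inner_ge0 X (a [+] b)) as P. revert P H. inner_expand. lra. }
  apply Hfitz in Hs. simpl in Hs.
  (* By monotonicity ((y, z), <y, z>) lies in the epigraph, so it may be tested in the variational
     inequality. *)
  assert (Hyz : forall y z, T y z -> <<u [+] v, u [+] v>> <= <<y [+] v, z [+] u>>).
  { intros y z H. specialize (Hvar (y, z) (<<y, z>>)). simpl in Hvar.
    assert (<<u, v>> + (<<u, u>> + <<v, v>>) <= <<y, z>> + (<<u, y>> + <<v, z>>)).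
    { eapply Rle_trans; [|apply Hvar]; [lra|].
      intros [z' y'] b [H' ->]. simpl in *. specialize (Hmon y z y' z' H H').
      revert Hmon. inner_expand. lra. }
    revert H0 Hs. inner_expand. lra. }
  assert (T (H_opp X v) (H_opp X u)) as Tuv.
  { apply Hrel. intros y z H. specialize (Hyz y z H). pose proof (H_inner_ge0 X (u [+] v)).
    replace (<<H_opp X u [-] z, H_opp X v [-] y>>) with (<<y [+] v, z [+] u>>)
      by (inner_expand; ring). lra. }
  (* At y = - v, z = - u the right-hand side vanishes, hence u + v = 0. *)
  specialize (Hyz _ _ Tuv).
  exists (H_opp X v). replace (H_opp X (H_opp X v)) with (H_opp X u); auto.
  apply hilbert_eq. pose proof (H_inner_ge0 X (u [+] v)) as P.
  revert Hyz P. inner_expand. lra.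
Qed.

(** Translating the values by [y] keeps maximal monotonicity and reduces the claim to target
    zero. *)
Lemma maximal_monotone_onto (X : Hilbert) (T : setmap X) (y : X) :
  proper T -> maximal_monotone T -> exists u v, T u v /\ v [+] u = y.
Proof.
  intros [u1 [v1 H1]] [Hmon Hmax].
  destruct (maximal_monotone_zero X (fun u v => T u (v [+] y))) as [u Hu].
  - exists u1, (v1 [-] y). replace (v1 [-] y [+] y) with v1 by vec. exact H1.
  - split.
    + intros a b a' b' H H'. specialize (Hmon _ _ _ _ H H').
      replace (b [-] b') with ((b [+] y) [-] (b' [+] y)) by vec. exact Hmon.
    + intros S HS HTS u v Huv.
      apply (Hmax (fun a b => S a (b [-] y))).
      * intros a b a' b' H H'. specialize (HS _ _ _ _ H H').
        replace (b [-] b') with ((b [-] y) [-] (b' [-] y)) by vec. exact HS.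
      * intros a b H. apply HTS. replace (b [-] y [+] y) with b by vec. exact H.
      * replace (v [+] y [-] y) with v by vec. exact Huv.
  - exists u, (H_opp X u [+] y). split; [exact Hu|vec].
Qed.

(** * Positivity of the coderivative of a maximal monotone mapping *)

Lemma maximal_monotone_positive_coderivative (X : Hilbert) (T : setmap X) :
  proper T -> maximal_monotone T -> positive_coderivative X T.
Proof.
  intros Hprop Hmax u v Huv w z Hn. apply Rnot_lt_le. intros N.
  set (m := hnorm (z [-] w)). set (k := hnorm (z [+] w)).
  assert (Hk : 0 <= k) by apply hnorm_ge0. assert (Hm0 : 0 <= m) by apply hnorm_ge0.
  assert (Em : m ^ 2 = k ^ 2 - 4 * <<z, w>>)
    by (unfold m, k; rewrite !hnorm_sq; inner_expand; ring).
  assert (Hkm : k < m) by nra.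
  (* Half of the gain (m - k) / 2 obtained at the end, so a contradiction remains. *)
  destruct (Hn ((m - k) / 4)) as (delta & Hd & Hineq); [lra|].
  (* Makes |c| = delta / 2, which bounds the displacement in the graph below [delta]. *)
  set (t := delta / (2 * m)).
  assert (Ht : 0 < t) by (apply Rdiv_lt_0_compat; lra).
  assert (Etm : t * m = delta / 2) by (unfold t; field; lra).
  set (c := t [*] (z [-] w)).
  destruct (maximal_monotone_onto X T (v [+] u [+] c) Hprop Hmax) as (u' & v' & H' & E).
  specialize (Hineq u' v' H').
  set (a := u' [-] u) in *.
  assert (Eb : v' [-] v = c [-] a).
  { replace v' with (v [+] u [+] c [-] u') by (rewrite <- E; vec). unfold a; vec. }
  rewrite Eb in Hineq.
  assert (Hab : 0 <= <<c [-] a, a>>).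
  { rewrite <- Eb. apply (proj1 Hmax); auto. }
  (* The midpoint form of <a, c - a> >= 0: a lies in the ball with diameter [0, c]. *)
  set (f := a [-] (/ 2) [*] c).
  assert (Ec : hnorm c = t * m) by (unfold c; rewrite hnorm_scal; unfold m; lra).
  assert (Hf : hnorm f <= t * m / 2).
  { apply sq_le_le; [nra|]. replace ((t * m / 2) ^ 2) with (hnorm c ^ 2 / 4) by (rewrite Ec; field).
    rewrite !hnorm_sq. unfold f. revert Hab. clearbody a c. inner_expand. lra. }
  assert (Ep : pnorm a (c [-] a) ^ 2 = (t * m) ^ 2 - 2 * <<c [-] a, a>>).
  { rewrite <- Ec. unfold pnorm.
    rewrite pow2_sqrt by (apply Rplus_le_le_0_compat; apply pow2_ge_0).
    rewrite !hnorm_sq. clearbody a c. inner_expand. ring. }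
  assert (Hp0 : 0 <= pnorm a (c [-] a)) by apply sqrt_pos.
  assert (Hp : pnorm a (c [-] a) <= t * m) by (apply sq_le_le; lra).
  assert (Hp1 : 0 < pnorm a (c [-] a)).
  { pose proof (fst_le_pnorm X a (c [-] a)). pose proof (snd_le_pnorm X a (c [-] a)).
    pose proof (hnorm_add X (c [-] a) a) as T1. replace (c [-] a [+] a) with c in T1 by vec. lra. }
  specialize (Hineq ltac:(lra)).
  (* Centred at c / 2, the pairing is t m^2 / 2 + <z + w, f>, at least t m (m - k) / 2 because |f|
     <= t m / 2. *)
  replace (<<z, a>> + <<H_opp X w, c [-] a>>)
    with (t * m ^ 2 / 2 + <<z [+] w, f>>) in Hineq
    by (unfold f, m; rewrite hnorm_sq; unfold c; clearbody a t; inner_expand; field).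
  pose proof (inner_ge X (z [+] w) f) as C. fold k in C.
  assert (k * hnorm f <= k * (t * m / 2)) by (apply Rmult_le_compat_l; lra).
  assert ((m - k) / 4 * pnorm a (c [-] a) <= (m - k) / 4 * (t * m))
    by (apply Rmult_le_compat_l; lra).
  assert (t * m * (m - k) <= 0) by lra.
  assert (0 < t * m) by nra. nra.
Qed.

Theorem theorem3p5 (X : Hilbert) (T : setmap X)
  (Hprop : proper T) (Hclosed : closed_graph T) (Hconv : convex (dom T)) :
  maximal_monotone T <->
  (semilocally_hypomonotone T /\
   forall u v, T u v -> forall w z, reg_coderiv T u v w z -> 0 <= H_inner X z w).
Proof.
  split.
  - intros Hmax. split; [|exact (maximal_monotone_positive_coderivative X T Hprop Hmax)].
    intros ub Hub. split; auto. exists (fun _ => True), 1.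
    split; [exists 1; split; auto; lra|split; [lra|]].
    intros u1 v1 u2 v2 H1 H2 _ _. pose proof (proj1 Hmax u1 v1 u2 v2 H1 H2).
    pose proof (pow2_ge_0 (hnorm (u1 [-] u2))). lra.
  - intros [Hhyp Hpos]. apply monotone_onto_maximal.
    + apply locally_monotone_monotone; auto. intros ub Hub.
      apply hypomonotone_locally_monotone; auto.
    + intros y. destruct Hprop as [u0 [v0 H0]].
      (* [lam = 1] turns covering into surjectivity of T + I. *)
      destruct (coderivative_covering X T 1 (/ 2) 1 u0 v0 y) as (u & v & Huv & E & _); auto; try lra.
      exists u, v. split; auto. rewrite <- E. vec.
Qed.
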